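(* Let $k\geq 3$ be an integer, and let $n$ be an even positive integer. Then $$A_n(12\cdots k)=A_n(12\cdots k(k-1)),$$ where $12\cdots k$ is the increasing permutation of length $k$, and $12\cdots k(k-1)$ denotes the permutation $1\,2\cdots (k-2)\,k\,(k-1)$ of length $k$, obtained from $12\cdots k$ by interchanging its last two entries.
   Context: A permutation of length $n$ is written in one-line notation $p=p_1p_2\cdots p_n$, a rearrangement of $1,2,\dots,n$. Let $q=q_1q_2\cdots q_k$ be a permutation of length $k$. The permutation $p$ avoids the pattern $q$ if there are no $k$ indices $i_1<i_2<\cdots<i_k$ such that for all $a$ and $b$, $p_{i_a}<p_{i_b}$ holds if and only if $q_a<q_b$ holds (in particular, if $k>n$, then $p$ avoids $q$ trivially). The permutation $p$ is called alternating if $p_1<p_2>p_3<p_4>\cdots$, that is, for every $1\le i\le n-1$, $p_i<p_{i+1}$ if and only if $i$ is odd. $A_n(q)$ denotes the number of alternating permutations of length $n$ that avoid the pattern $q$. *)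

(* Defs.v *)
From mathcomp Require Import all_boot all_fingroup.

Set Implicit Arguments.
Unset Strict Implicit.
Unset Printing Implicit Defensive.

(* A permutation p_1 ... p_n of 1, ..., n is encoded as p : 'S_n with both
   positions and values shifted down by one: p_i is (p (i - 1)) + 1. *)

Definition increasing k n (f : {ffun 'I_k -> 'I_n}) : bool :=
  [forall a : 'I_k, forall b : 'I_k, (a < b) ==> (f a < f b)].

Definition occurrence k n (q : 'S_k) (p : 'S_n) (f : {ffun 'I_k -> 'I_n}) :
    bool :=
  increasing f &&
  [forall a : 'I_k, forall b : 'I_k, (p (f a) < p (f b)) == (q a < q b)].

Definition avoids k n (q : 'S_k) (p : 'S_n) : bool :=
  ~~ [exists f : {ffun 'I_k -> 'I_n}, occurrence q p f].

(* The ascents are at odd positions counted from 1, hence at the even positions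
   counted from 0. *)
Definition alternating n (p : 'S_n) : bool :=
  [forall i : 'I_n, forall j : 'I_n,
     (nat_of_ord j == i.+1) ==> ((p i < p j) == ~~ odd i)].

Definition A n k (q : 'S_k) : nat :=
  #|[set p : 'S_n | alternating p && avoids q p]|.

Definition incr_pattern k : 'S_k := 1%g.

(* The junk value 1 is only taken for k < 2. *)
Definition incr_swap_pattern k : 'S_k :=
  match k return 'S_k with
  | m.+2 => tperm (inord m) ord_max
  | _ => 1%g
  end.

(* Main.v *)
Require Import Defs.
From mathcomp Require Import all_boot all_fingroup.
From mathcomp Require Import zify.

(** Write [k = m + 3].  Call an entry of a permutation [p] high if an increasing
    subsequence of length [k - 1] ends at it, and low otherwise.  Two
    permutations are equivalent when they have the same high positions and
    carry the same entries at the low ones; such permutations differ only in the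
    arrangement of the high entries.

    An occurrence of either pattern amounts to positions [s < i < j] such that
    an increasing subsequence of length [k - 2] ends at [s], the entries at [i]
    and [j] exceed the one at [s], and the entries at [i] and [j] are in
    increasing order (for [1 2 ... k]) or in decreasing order (for the other
    pattern); see [avoidsE].

    Each equivalence class contains exactly one avoider of each pattern.
    Existence ([exists_avoider]): exchanging the entries at [i] and [j] in an
    occurrence stays in the class ([low_equiv_swap]), so a minimum of
    [\sum_x x * p x] over the class avoids the increasing pattern, and a maximum
    avoids the other one.  Uniqueness ([avoider_unique]): if equivalent [p] and
    [p'] first differ at [i], and [p i < p' i], then the entries [p' i] in [p]
    and [p i] in [p'] occur to the right of [i], so [p] contains the increasing
    pattern and [p'] the other one.

    Finally, in an alternating permutation of even length that avoids one of the
    patterns, all high entries are peaks ([high_odd]); this forces every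
    equivalent permutation to be alternating ([alternating_low_equiv]).  Hence a
    class with an alternating avoider of one pattern consists of alternating
    permutations, and its unique avoider of the other pattern is alternating
    too. *)

Set Implicit Arguments.
Unset Strict Implicit.
Unset Printing Implicit Defensive.

(** * Increasing subsequences ending at a position *)

(** An increasing subsequence of [p] of length [m.+1] ends at position [x]. *)
Fixpoint chain_end n (p : 'S_n) (m : nat) (x : 'I_n) : bool :=
  if m is m'.+1 then [exists y : 'I_n, [&& y < x, p y < p x & chain_end p m' y]]
  else true.

Lemma chain_endS n (p : 'S_n) m (x y : 'I_n) :
  y < x -> p y < p x -> chain_end p m y -> chain_end p m.+1 x.
Proof. by move=> yx pyx cy; apply/existsP; exists y; apply/and3P. Qed.

Lemma chain_endSP n (p : 'S_n) m (x : 'I_n) :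
  chain_end p m.+1 x -> exists y : 'I_n, [/\ y < x, p y < p x & chain_end p m y].
Proof. by case/existsP=> y /and3P[? ? ?]; exists y. Qed.

Lemma chain_endW n (p : 'S_n) m m' (x : 'I_n) :
  m' <= m -> chain_end p m x -> chain_end p m' x.
Proof.
elim: m' m x => [//|m' IH] [//|m] x le_m'm /chain_endSP[y [yx pyx cy]].
exact: chain_endS yx pyx (IH _ _ le_m'm cy).
Qed.

(** Whether a chain ends at [x] depends only on the entries up to [x]. *)
Lemma chain_end_prefix n (p p' : 'S_n) m (x : 'I_n) :
    (forall y : 'I_n, y <= x -> p y = p' y) ->
  chain_end p m x -> chain_end p' m x.
Proof.
elim: m x => [//|m IH] x eq_pp' /chain_endSP[y [yx pyx cy]].
apply: (@chain_endS _ _ _ _ y) => //; first by rewrite -!eq_pp' // ltnW.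
by apply: IH cy => z zy; apply: eq_pp'; apply: leq_trans zy (ltnW yx).
Qed.

(** An increasing subsequence of length [m.+1], listed by a function on [nat]
    whose values beyond [m] are irrelevant. *)
Lemma chain_end_seq n (p : 'S_n) m (x : 'I_n) :
  chain_end p m x ->
  exists2 f : nat -> 'I_n, f m = x &
    forall a b, a < b <= m -> f a < f b /\ p (f a) < p (f b).
Proof.
elim: m x => [|m IH] x; first by exists (fun=> x) => // a b; lia.
case/chain_endSP=> y [yx pyx /IH[f fm f_incr]].
exists (fun a => if a <= m then f a else x); first by rewrite ltnn.
move=> a b /andP[ab]; rewrite leq_eqVlt => /predU1P[eq_b | lt_bm].
  have am : a <= m by lia.
  rewrite eq_b ltnn am; move: am; rewrite leq_eqVlt => /predU1P[->|am].
    by rewrite fm.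
  by have := f_incr a m; rewrite fm am leqnn => -[] // ? ?; split; lia.
have -> : a <= m by lia.
have -> : b <= m by lia.
by apply: f_incr; rewrite ab.
Qed.

(** * Occurrences of the two patterns *)

(** For [b = true] this is an occurrence of the increasing pattern of length
    [m.+3], for [b = false] of the pattern with its last two entries swapped. *)
Definition occurs_at n (b : bool) m (p : 'S_n) (s i j : 'I_n) : bool :=
  [&& chain_end p m s, s < i, i < j, p s < p i, p s < p j &
      (p i < p j) == b].

Definition contains n (b : bool) m (p : 'S_n) : bool :=
  [exists s : 'I_n, exists i : 'I_n, exists j : 'I_n, occurs_at b m p s i j].

Lemma containsP n b m (p : 'S_n) :
  reflect (exists s i j, occurs_at b m p s i j) (contains b m p).
Proof.
apply: (iffP existsP) => [[s /existsP[i /existsP[j o]]]|[s [i [j o]]]].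
  by exists s, i, j.
by exists s; apply/existsP; exists i; apply/existsP; exists j.
Qed.

Lemma ltn_perm_asym n (p : 'S_n) (x y : 'I_n) :
  x != y -> (p x < p y) = ~~ (p y < p x).
Proof.
move=> xy; rewrite -leqNgt ltn_neqAle; case: eqP => // /val_inj /perm_inj exy.
by rewrite exy eqxx in xy.
Qed.

Lemma fixed_prefix_gt m (q : 'S_m.+3) (a : 'I_m.+3) :
    (forall c : 'I_m.+3, c <= m -> q c = c) ->
  m < a -> m < q a.
Proof.
move=> qfix; rewrite !ltnNge; apply: contraNN => le_qa.
by have /perm_inj <- := qfix _ le_qa.
Qed.

Lemma avoidsE n m (q : 'S_m.+3) (p : 'S_n) (b : bool) :
    (forall c : 'I_m.+3, c <= m -> q c = c) ->
    (q (inord m.+1) < q (inord m.+2)) = b ->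
  avoids q p = ~~ contains b m p.
Proof.
move=> qfix qb; congr (~~ _); apply/existsP/containsP.
  case=> f /andP[/forallP f_incr /forallP f_q].
  pose g a := f (inord a).
  have g_incr a c : a < c < m.+3 -> g a < g c.
    case/andP=> ac cm; have /forallP/(_ (inord c))/implyP := f_incr (inord a).
    by rewrite !inordK //; [apply | apply: ltn_trans cm].
  have g_q a c : (p (g a) < p (g c)) = (q (inord a) < q (inord c)).
    by have /forallP/(_ (inord c))/eqP := f_q (inord a).
  have q_id a : a <= m -> q (inord a) = a :> nat.
    by move=> am; rewrite qfix inordK //; lia.
  have q_gt a : m < a < m.+3 -> m < q (inord a).
    by case/andP=> ma am; apply: fixed_prefix_gt => //; rewrite inordK.
  have g_chain a : a <= m -> chain_end p a (g a).
    elim: a => [//|a IH] am; apply: chain_endS (IH (ltnW am)).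
      by apply: g_incr; lia.
    by rewrite g_q !q_id //; lia.
  exists (g m), (g m.+1), (g m.+2); rewrite /occurs_at g_chain // !g_incr; try lia.
  by rewrite !g_q q_id // !q_gt ?qb ?eqxx //; lia.
case=> s [i [j]] /and5P[/chain_end_seq[f fm f_incr] si ij psi /andP[psj /eqP pij]].
pose g a := if a <= m then f a else if a == m.+1 then i else j.
have below a : a <= m -> f a <= s /\ p (f a) <= p s.
  rewrite leq_eqVlt => /predU1P[->|am]; first by rewrite fm.
  by have := f_incr a m; rewrite fm am leqnn => -[] // ? ?; split; apply: ltnW.
have g_incr (a c : 'I_m.+3) : a < c -> g a < g c.
  move=> ac; rewrite /g; have ltc := ltn_ord c.
  case: (leqP a m) => am; case: (leqP c m) => cm; try lia.
  - by case: (f_incr a c); rewrite ?ac.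
  - by have [? _] := below _ am; case: eqP => ?; lia.
  - have -> : a = m.+1 :> nat by lia.
    have -> : c = m.+2 :> nat by lia.
    by rewrite eqxx gtn_eqF.
have g_q (a c : 'I_m.+3) : a < c -> (p (g a) < p (g c)) = (q a < q c).
  move=> ac; rewrite /g; have ltc := ltn_ord c.
  case: (leqP a m) => am; case: (leqP c m) => cm; try lia.
  - by rewrite !qfix // ac; case: (f_incr a c); rewrite ?ac.
  - have [_ ?] := below _ am; rewrite qfix //.
    have := fixed_prefix_gt qfix cm => ?.
    by transitivity true; [case: eqP => ? | symmetry]; lia.
  - have ea : a = m.+1 :> nat by lia.
    have ec : c = m.+2 :> nat by lia.
    have <- : inord m.+1 = a by apply/val_inj; rewrite /= inordK.
    have <- : inord m.+2 = c by apply/val_inj; rewrite /= inordK.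
    by rewrite qb !inordK // eqxx gtn_eqF.
exists [ffun a : 'I_m.+3 => g a]; apply/andP; split.
  by apply/forallP=> a; apply/forallP=> c; apply/implyP; rewrite !ffunE; exact: g_incr.
apply/forallP=> a; apply/forallP=> c; rewrite !ffunE; apply/eqP.
case: (ltnP a c) => [ac|]; first by rewrite g_q // ac.
rewrite leq_eqVlt => /predU1P[/val_inj->|ca]; first by rewrite !ltnn.
rewrite ltn_perm_asym; last by apply/eqP=> e; have := g_incr _ _ ca; rewrite e ltnn.
rewrite [RHS]ltn_perm_asym ?g_q //.
by apply/eqP=> e; rewrite e ltnn in ca.
Qed.

Lemma avoids_incr n m (p : 'S_n) :
  avoids (incr_pattern m.+3) p = ~~ contains true m p.
Proof.
by apply: avoidsE => [c _|]; rewrite /incr_pattern !perm1 // !inordK ?ltnSn.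
Qed.

Lemma avoids_incr_swap n m (p : 'S_n) :
  avoids (incr_swap_pattern m.+3) p = ~~ contains false m p.
Proof.
have max : inord m.+2 = ord_max :> 'I_m.+3 by apply/val_inj; rewrite /= inordK.
apply: avoidsE => [c cm|] /=.
  by rewrite tpermD //; apply/eqP=> /(congr1 val); rewrite /= ?inordK; lia.
by rewrite max tpermL tpermR inordK //= ltnNge leqnSn.
Qed.

(** * Permutations with the same low entries *)

(** The entry at [x] is high when an increasing subsequence of length [m.+2]
    ends there.  Equivalent permutations have the same high positions and agree
    at the other ones. *)
Definition low_equiv n m (p p' : 'S_n) : bool :=
  [forall x, (chain_end p m.+1 x == chain_end p' m.+1 x) &&
             (chain_end p m.+1 x || (p x == p' x))].

Lemma low_equivP n m (p p' : 'S_n) :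
  reflect ((forall x, chain_end p m.+1 x = chain_end p' m.+1 x) /\
           (forall x, ~~ chain_end p m.+1 x -> p x = p' x))
          (low_equiv m p p').
Proof.
apply: (iffP forallP) => [eqv | [eq_high eq_low] x].
  split=> x; have /andP[/eqP // _ /orP[-> //|/eqP //]] := eqv x.
by rewrite eq_high eqxx -eq_high /= -implyNb; apply/implyP=> /eq_low ->.
Qed.

Lemma low_equiv_refl n m (p : 'S_n) : low_equiv m p p.
Proof. by apply/low_equivP. Qed.

Lemma low_equiv_sym n m (p p' : 'S_n) : low_equiv m p p' -> low_equiv m p' p.
Proof.
case/low_equivP=> eq_high eq_low; apply/low_equivP; split=> x //.
by rewrite -eq_high => /eq_low.
Qed.

Lemma low_equiv_trans n m (p1 p2 p3 : 'S_n) :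
  low_equiv m p1 p2 -> low_equiv m p2 p3 -> low_equiv m p1 p3.
Proof.
case/low_equivP=> eq_high1 eq_low1 /low_equivP[eq_high2 eq_low2].
apply/low_equivP; split=> x; first by rewrite eq_high1.
by move=> low; rewrite eq_low1 // eq_low2 // -eq_high1.
Qed.

Lemma chain_end_swap_sub n m l (p : 'S_n) (s i j : 'I_n) (x : 'I_n) :
    (forall y, chain_end p l y -> chain_end (tperm i j * p)%g l y) ->
    chain_end p m s -> s < i -> i < j -> p s < p i -> p s < p j -> l <= m ->
  chain_end p l.+1 x -> chain_end (tperm i j * p)%g l.+1 x.
Proof.
move=> IH cs si ij psi psj lm /chain_endSP[y [yx pyx cy]].
have cs' := IH _ (chain_endW lm cs).
have p's : (tperm i j * p)%g s = p s.
  by rewrite permM tpermD //; apply/eqP=> e; rewrite e in si ij *; lia.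
(* A chain through [i] or [j] is rerouted through [s]. *)
have via_s : s < x -> p s < (tperm i j * p)%g x ->
    chain_end (tperm i j * p)%g l.+1 x.
  by move=> sx psx; apply: chain_endS cs' => //; rewrite p's.
have [xi | nxi] := eqVneq x i.
  by apply: via_s; rewrite xi // permM tpermL.
have [xj | nxj] := eqVneq x j.
  by apply: via_s; rewrite xj ?permM ?tpermR // (ltn_trans si).
have p'x : (tperm i j * p)%g x = p x by rewrite permM tpermD // eq_sym.
have [yi | nyi] := eqVneq y i; first by subst y; apply: via_s; rewrite ?p'x; lia.
have [yj | nyj] := eqVneq y j; first by subst y; apply: via_s; rewrite ?p'x; lia.
apply: chain_endS yx _ (IH _ cy).
by rewrite p'x permM tpermD // eq_sym.
Qed.

Lemma chain_end_swap n m l (p : 'S_n) (s i j : 'I_n) (x : 'I_n) :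
    chain_end p m s -> s < i -> i < j -> p s < p i -> p s < p j -> l <= m.+1 ->
  chain_end (tperm i j * p)%g l x = chain_end p l x.
Proof.
move=> cs si ij psi psj; elim: l x => [//|l IH] x lm.
have {}IH y := IH y (ltnW lm).
apply/idP/idP; last by apply: chain_end_swap_sub cs _ _ _ _ _ => // y; rewrite IH.
(* The exchange is an involution, and its result satisfies the same hypotheses
   with [l] instead of [m]. *)
set p' := (tperm i j * p)%g.
have defp : p = (tperm i j * p')%g by rewrite mulgA tperm2 mul1g.
have p's : p' s = p s.
  by rewrite permM tpermD //; apply/eqP=> e; rewrite e in si ij *; lia.
rewrite [in X in _ -> X]defp; apply: (@chain_end_swap_sub _ l _ _ s) => //.
- by move=> y; rewrite -defp IH.
- by rewrite IH; apply: chain_endW cs.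
- by rewrite p's permM tpermL.
- by rewrite p's permM tpermR.
Qed.

(** Exchanging the last two entries of an occurrence of either pattern moves
    only high entries and keeps them high. *)
Lemma low_equiv_swap n b m (p : 'S_n) (s i j : 'I_n) :
  occurs_at b m p s i j -> low_equiv m p (tperm i j * p)%g.
Proof.
case/and5P=> cs si ij psi /andP[psj _]; apply/low_equivP; split=> x.
  by rewrite (chain_end_swap _ cs).
move=> low; rewrite permM tpermD //; apply: contraNneq low => <-.
  exact: chain_endS si psi cs.
exact: chain_endS (ltn_trans si ij) psj cs.
Qed.

(** * Each class contains exactly one avoider of each pattern *)

(** Exchanging two entries in increasing order lowers the weight, so its extrema
    over a class have no occurrence left to exchange. *)
Definition weight n (p : 'S_n) : nat := \sum_(x < n) x * p x.

Lemma weight_swap n (p : 'S_n) (i j : 'I_n) :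
  i < j -> p i < p j -> weight (tperm i j * p)%g < weight p.
Proof.
move=> ij pij; have ji : j != i by rewrite -val_eqE gtn_eqF.
have split (p' : 'S_n) : weight p' =
    i * p' i + j * p' j + \sum_(x < n | (x != i) && (x != j)) x * p' x.
  by rewrite /weight (bigD1 i) //= (bigD1 j ji) /= addnA.
rewrite !split !permM tpermL tpermR.
rewrite (eq_bigr (fun x : 'I_n => x * p x)) => [|x /andP[xi xj]].
  by rewrite ltn_add2r; nia.
by rewrite permM tpermD // eq_sym.
Qed.

Lemma exists_avoider n b m (p : 'S_n) :
  exists2 p', low_equiv m p p' & ~~ contains b m p'.
Proof.
case: b.
  case: (arg_minnP (@weight n) (low_equiv_refl m p)) => p' eqv p'_min.
  exists p' => //; apply/containsP=> -[s [i [j occ]]].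
  have := p'_min _ (low_equiv_trans eqv (low_equiv_swap occ)).
  case/and5P: occ => _ _ ij _ /andP[_ /eqP pij].
  by rewrite leqNgt weight_swap.
have [p' eqv p'_max] := @arg_maxnP _ p (low_equiv m p) (@weight n) (low_equiv_refl m p).
exists p' => //; apply/containsP=> -[s [i [j occ]]].
have := p'_max _ (low_equiv_trans eqv (low_equiv_swap occ)).
case/and5P: occ => _ _ ij _ /andP[_ /eqP/negbT pij].
have {1}-> : p' = (tperm i j * (tperm i j * p'))%g by rewrite mulgA tperm2 mul1g.
rewrite /= leqNgt weight_swap // !permM tpermL tpermR.
by rewrite ltn_perm_asym // -val_eqE gtn_eqF.
Qed.

(** If [p] precedes [p'] lexicographically, then [p] contains the increasing
    pattern and [p'] the other one. *)
Lemma first_difference n m (p p' : 'S_n) (i : 'I_n) :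
    low_equiv m p p' -> (forall x : 'I_n, x < i -> p x = p' x) -> p i < p' i ->
  contains true m p /\ contains false m p'.
Proof.
move=> /low_equivP[eq_high eq_low] eq_lt lt_i.
have /chain_endSP[s [si psi cs]] : chain_end p m.+1 i.
  by apply: contraLR lt_i => /eq_low->; rewrite ltnn.
have cs' : chain_end p' m s.
  by apply: chain_end_prefix cs => y ys; apply/eq_lt/(leq_ltn_trans ys).
split; apply/containsP.
  (* [j] is the position in [p] of the entry [p' i]. *)
  pose j := (p^-1)%g (p' i); have pj : p j = p' i by rewrite permKV.
  have ij : i < j.
    rewrite ltnNge; apply/negP; rewrite leq_eqVlt.
    case/predU1P=> [/val_inj ji | ji]; first by rewrite -pj ji ltnn in lt_i.
    by move: pj; rewrite eq_lt // => /perm_inj e; rewrite e ltnn in ji.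
  by exists s, i, j; rewrite /occurs_at cs si ij psi pj (ltn_trans psi) // lt_i.
pose j := (p'^-1)%g (p i); have p'j : p' j = p i by rewrite permKV.
have ij : i < j.
  rewrite ltnNge; apply/negP; rewrite leq_eqVlt.
  case/predU1P=> [/val_inj ji | ji]; first by rewrite -p'j ji ltnn in lt_i.
  by move: p'j; rewrite -eq_lt // => /perm_inj e; rewrite e ltnn in ji.
exists s, i, j; rewrite /occurs_at cs' si ij -eq_lt // p'j psi (ltn_trans psi) //=.
by rewrite ltnNge ltnW.
Qed.

Lemma avoider_unique n b m (p p' : 'S_n) :
    low_equiv m p p' -> ~~ contains b m p -> ~~ contains b m p' ->
  p = p'.
Proof.
move=> eqv av av'; apply/permP=> i0; apply/eqP; apply: contraT => diff.
case: (arg_minnP (fun x : 'I_n => x : nat) (P := fun x => p x != p' x) diff).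
move=> i neq i_min {i0 diff}.
have eq_lt (x : 'I_n) : x < i -> p x = p' x.
  by move=> xi; apply/eqP; apply: contraTT xi => /i_min; rewrite -leqNgt.
case: (ltngtP (p i) (p' i)) => [lt_i | gt_i | /val_inj e]; last by rewrite e eqxx in neq.
  have [c c'] := first_difference eqv eq_lt lt_i.
  by case: b av av'; rewrite ?c ?c'.
have [|c' c] := first_difference (low_equiv_sym eqv) _ gt_i.
  by move=> x /eq_lt.
by case: b av av'; rewrite ?c ?c'.
Qed.

(** * Alternation *)

Lemma alternatingP n (p : 'S_n) :
  reflect (forall i j : 'I_n, j = i.+1 :> nat -> (p i < p j) = ~~ odd i)
          (alternating p).
Proof.
apply: (iffP forallP) => [alt i j ji | alt i].
  by have /forallP/(_ j)/implyP := alt i; rewrite ji eqxx => /(_ isT)/eqP.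
by apply/forallP=> j; apply/implyP=> /eqP/alt->.
Qed.

(** Positions are counted from 0, so the peaks are at the odd positions. *)
Lemma high_odd n b m (p : 'S_n) (i : 'I_n) :
    ~~ odd n -> alternating p -> ~~ contains b m p -> chain_end p m.+1 i ->
  odd i.
Proof.
move=> n_even /alternatingP alt av /chain_endSP[s [si psi cs]].
apply: contraNT av => i_even; apply/containsP; case: b.
  (* A valley is followed by a larger entry, because the length is even. *)
  have i1 : i.+1 < n.
    rewrite ltn_neqAle ltn_ord andbT; apply: contraNneq n_even => <-.
    by rewrite /= i_even.
  have pi1 : p i < p (Ordinal i1) by rewrite alt.
  exists s, i, (Ordinal i1).
  by rewrite /occurs_at cs si psi /= ltnSn pi1 (ltn_trans psi).
(* A valley that is not the first entry is preceded by a larger one. *)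
have i0 : i.-1 < n by apply: leq_ltn_trans (ltn_ord i); apply: leq_pred.
pose j := Ordinal i0; have ij : i = j.+1 :> nat by rewrite /=; lia.
have pji : (p j < p i) = false by rewrite (alt _ _ ij); move: i_even; rewrite ij; lia.
have sj : s < j.
  rewrite ltn_neqAle -ltnS -ij si andbT.
  by apply: contraTneq psi => /val_inj->; rewrite pji.
exists s, j, i; rewrite /occurs_at cs sj psi pji ij ltnSn /= andbT.
by apply: leq_trans psi _; rewrite leqNgt pji.
Qed.

Lemma alternating_low_equiv n b m (p p' : 'S_n) :
    ~~ odd n -> alternating p -> ~~ contains b m p -> low_equiv m p p' ->
  alternating p'.
Proof.
move=> n_even altp av /low_equivP[eq_high eq_low].
have high x : chain_end p' m.+1 x -> odd x.
  by rewrite -eq_high; apply: high_odd altp av.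
move/alternatingP: altp => alt; apply/alternatingP=> i j ji.
have ij : i != j by apply/eqP=> e; rewrite -e in ji; lia.
have [hi | li] := boolP (chain_end p' m.+1 i).
  (* A low entry to the right of a high one is smaller. *)
  have i_odd := high _ hi; rewrite i_odd.
  have lj : ~~ chain_end p' m.+1 j by apply: contraTN i_odd => /high; rewrite ji.
  apply: contraNF lj => p'ij; apply: (@chain_endS _ _ _ _ i) => //.
    by rewrite ji.
  exact: chain_endW hi.
have [hj | lj] := boolP (chain_end p' m.+1 j); last first.
  by rewrite -!eq_low ?eq_high //; apply: alt.
(* A low entry immediately to the left of a high one is smaller. *)
have := high _ hj; rewrite ji /= => ->.
case/chain_endSP: hj => s [sj psj cs].
rewrite ltn_perm_asym //; apply: contraNN li => p'ji.
have p'si := ltn_trans psj p'ji.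
apply: chain_endS (p'si) cs; rewrite ltn_neqAle -ltnS -ji sj andbT.
by apply: contraTneq p'si => /val_inj->; rewrite ltnn.
Qed.

Lemma leq_card_avoiders n b b' m :
    ~~ odd n ->
  #|[set p : 'S_n | alternating p && ~~ contains b m p]| <=
  #|[set p : 'S_n | alternating p && ~~ contains b' m p]|.
Proof.
move=> n_even.
pose avoider (p : 'S_n) := s2val (sig2W (exists_avoider b' m p)).
have eqv p : low_equiv m p (avoider p) by rewrite /avoider; case: sig2W.
have av p : ~~ contains b' m (avoider p) by rewrite /avoider; case: sig2W.
rewrite -(card_in_imset (f := avoider)); last first.
  move=> p p'; rewrite !inE => /andP[_ avp] /andP[_ avp'] eq_av.
  apply: avoider_unique avp avp'; apply: low_equiv_trans (eqv p) _.
  by rewrite eq_av; apply: low_equiv_sym.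
apply/subset_leq_card/subsetP=> _ /imsetP[p + ->]; rewrite !inE av andbT.
by case/andP=> altp avp; apply: alternating_low_equiv altp avp (eqv p).
Qed.

Theorem theorem3p1 (k n : nat) (hk : 3 <= k) (hn : 0 < n) (hn_even : ~~ odd n) :
  A n (incr_pattern k) = A n (incr_swap_pattern k).
Proof.
case: k hk => [|[|[|m]]] // _.
have AE b (q : 'S_m.+3) : (forall p : 'S_n, avoids q p = ~~ contains b m p) ->
    A n q = #|[set p : 'S_n | alternating p && ~~ contains b m p]|.
  by move=> avE; apply: eq_card => p; rewrite !inE avE.
rewrite (AE true) => [|p]; last exact: avoids_incr.
rewrite (AE false) => [|p]; last exact: avoids_incr_swap.
by apply/eqP; rewrite eqn_leq !leq_card_avoiders.
Qed.
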